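(* Let $X,Y$ be real Banach spaces, $A\subseteq X$ a nonempty compact convex set, $C\subseteq Y$ a closed convex cone with nonempty interior, and $F:X\to Y$ a continuous linear map with $F(X)\cap\operatorname{int}C\neq\emptyset$. Let $\theta$ be the associated merit function, assumed to satisfy $\theta(x)<+\infty$ for all $x\in X$. For $x\in A$ let $\varphi(x):=\inf\{\theta'(x;d): d\in T_A(x),\ \|d\|=1\}$. If $$\sup_{x\in A\setminus E_w}\varphi(x)<0,$$ then $\theta$ has an error bound on $A$, i.e. there exists $\tau>0$ such that $d(x,E_w)\le\tau\,\theta(x)$ for all $x\in A$.
   Context: $d(x,D)=d_D(x)=\inf_{u\in D}\|x-u\|$ with $d_\emptyset\equiv+\infty$; $\Delta_D(y)=d_D(y)-d_{Y\setminus D}(y)$ with conventions $\Delta_\emptyset\equiv+\infty$, $\Delta_Y\equiv-\infty$. $C^+=\{y^*\in Y^*:\langle y^*,c\rangle\ge 0\ \forall c\in C\}$, $S(C^+)=\{y^*\in C^+:\|y^*\|=1\}$. The merit function is $$\theta(x)=\sup_{a\in A}\bigl(-\Delta_C(F(x)-F(a))\bigr)=\sup_{a\in A}\inf_{y^*\in S(C^+)}\langle y^*,F(x)-F(a)\rangle .$$ $E_w=\{\bar x\in A: F(\bar x)\notin F(A)+\operatorname{int}C\}$ is the weakly efficient solution set. $T_A(x)=\{d\in X:\exists t_k\downarrow0,\ \exists d_k\to d,\ x+t_kd_k\in A\}$. $\theta'(x;d)=\lim_{t\downarrow0}\frac{\theta(x+td)-\theta(x)}{t}$, which exists and is finite since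 $\theta$ is concave and Lipschitz. Infima and suprema are taken in the extended reals ($\inf\emptyset=+\infty$, $\sup\emptyset=-\infty$). *)

(* Defs.v *)
From HB Require Import structures.
From mathcomp Require Import all_boot all_order all_algebra.
From mathcomp Require Import all_classical all_reals all_analysis.
Set Implicit Arguments.
Unset Strict Implicit.
Unset Printing Implicit Defensive.
Import Order.TTheory GRing.Theory Num.Theory numFieldNormedType.Exports.
Local Open Scope classical_set_scope.
Local Open Scope ring_scope.

Section Normed.
Context {R : realType}.

(* Closure under strictly positive scalars; a nonempty closed cone
   then automatically contains 0. *)
Definition cone {Y : normedModType R} (C : set Y) : Prop :=
  forall (t : R) (y : Y), 0 < t -> C y -> C (t *: y).

Definition dist_set {Y : normedModType R} (D : set Y) (y : Y) : \bar R :=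
  ereal_inf [set `|y - u|%:E | u in D].

(* Oriented (signed) distance, after Hiriart-Urruty. *)
Definition signed_dist {Y : normedModType R} (D : set Y) (y : Y) : \bar R :=
  (dist_set D y - dist_set (~` D) y)%E.

Lemma dist_set_set0 {Y : normedModType R} (y : Y) : dist_set set0 y = +oo%E.
Proof. by rewrite /dist_set image_set0 ereal_inf0. Qed.

Lemma dist_set_setT {Y : normedModType R} (y : Y) : dist_set setT y = 0%E.
Proof.
apply/eqP; rewrite eq_le; apply/andP; split.
  by apply: ereal_inf_lbound; exists y => //; rewrite subrr normr0.
by apply: le_ereal_inf_tmp => _ [u _ <-]; rewrite lee_fin normr_ge0.
Qed.

Lemma signed_dist_set0 {Y : normedModType R} (y : Y) :
  signed_dist set0 y = +oo%E.
Proof. by rewrite /signed_dist setC0 dist_set_set0 dist_set_setT sube0. Qed.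

Lemma signed_dist_setT {Y : normedModType R} (y : Y) :
  signed_dist setT y = -oo%E.
Proof. by rewrite /signed_dist setCT dist_set_set0 dist_set_setT sub0e. Qed.

Definition contingent_cone {X : normedModType R} (A : set X) (x : X) : set X :=
  [set d | exists (t : nat -> R) (e : nat -> X),
    [/\ forall k, 0 < t k, t @ \oo --> 0, e @ \oo --> d
      & forall k, A (x + t k *: e k)]].

(* Meaningful when the one-sided limit exists in the extended reals. *)
Definition dir_deriv {X : normedModType R} (f : X -> \bar R) (x d : X) :
    \bar R :=
  lim ((f (x + t *: d)%R - f x) * (t^-1)%R%:E @[t --> (0%R : R)^'+])%E.

Section VectorOptimization.
Context {X Y : normedModType R} (A : set X) (C : set Y) (F : X -> Y).

Definition weakly_efficient : set X :=
  [set x | A x /\ ~ [set u + c | u in F @` A & c in C°] (F x)].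

Definition merit (x : X) : \bar R :=
  ereal_sup [set (- signed_dist C (F x - F a)%R)%E | a in A].

Definition min_slope (x : X) : \bar R :=
  ereal_inf [set dir_deriv merit x d |
    d in [set d | contingent_cone A x d /\ `|d| = 1]].

End VectorOptimization.
End Normed.

(* Main.v *)
(* The merit function f is Lipschitz, and the slope condition says that
   from every point of A outside E_w there is a direction in the contingent
   cone along which f decreases at rate m > 0; by the Lipschitz property this
   yields z in A with f z < f y - (m/2) |z - y|.  Given x in A, let y minimise
   f + (m/2) |. - x| over the compact set A: the triangle inequality shows that
   such a z cannot exist, so y lies in E_w, and comparing with the value at x
   gives (m/2) |y - x| <= f x - f y <= f x (the compact case of Ekeland's
   variational principle). *)
Require Import Defs.
From HB Require Import structures.
From mathcomp Require Import all_boot all_order all_algebra.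
From mathcomp Require Import all_classical all_reals all_analysis.
From mathcomp Require Import lra.
Import Order.TTheory GRing.Theory Num.Theory numFieldNormedType.Exports.
Local Open Scope classical_set_scope.
Local Open Scope ring_scope.

Lemma dist_set_fin_num (R : realType) (Y : normedModType R) (D : set Y)
    (y : Y) : D !=set0 -> dist_set D y \is a fin_num.
Proof.
move=> [u Du]; rewrite ge0_fin_numE.
  by apply: le_lt_trans (ltry `|y - u|); apply: ereal_inf_lbound; exists u.
by apply: le_ereal_inf_tmp => _ [v _ <-]; rewrite lee_fin.
Qed.

Lemma le_dist_setD (R : realType) (Y : normedModType R) (D : set Y) (y z : Y) :
  (dist_set D y <= dist_set D z + `|y - z|%:E)%E.
Proof.
rewrite -leeBlDr//; apply: le_ereal_inf_tmp => _ [u Du <-].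
rewrite leeBlDr//; apply: (@le_trans _ _ `|y - u|%:E).
  by apply: ereal_inf_lbound; exists u.
by rewrite -EFinD lee_fin [leRHS]addrC ler_distD.
Qed.

Lemma signed_dist_fin_num (R : realType) (Y : normedModType R) (D : set Y)
    (y : Y) : D !=set0 -> ~` D !=set0 -> signed_dist D y \is a fin_num.
Proof. by move=> D0 D1; rewrite fin_numB !dist_set_fin_num. Qed.

(** Each of the two distances is 1-Lipschitz, hence the factor 2. Nonemptiness of [D] and of its
    complement keeps the difference finite. *)
Lemma le_signed_distD (R : realType) (Y : normedModType R) (D : set Y)
    (y z : Y) : D !=set0 -> ~` D !=set0 ->
  (signed_dist D y <= signed_dist D z + (2 * `|y - z|)%:E)%E.
Proof.
move=> D0 D1; rewrite /signed_dist.
have := le_dist_setD R Y D y z.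
have := le_dist_setD R Y (~` D) z y.
have := dist_set_fin_num R Y D y D0; have := dist_set_fin_num R Y D z D0.
have := dist_set_fin_num R Y _ y D1; have := dist_set_fin_num R Y _ z D1.
case: (dist_set (~` D) z) => // a _; case: (dist_set (~` D) y) => // b _.
case: (dist_set D z) => // c _; case: (dist_set D y) => // e _.
by rewrite -!EFinN -!EFinD !lee_fin (distrC z); lra.
Qed.

(** [cone] allows only positive scalars, so 0 is reached as the limit of [t *: c] as [t] decreases
    to 0. *)
Lemma closed_cone0 (R : realType) (Y : normedModType R) (C : set Y) :
  C !=set0 -> closed C -> cone C -> C 0.
Proof.
move=> [c Cc] C_closed C_cone.
apply: (closed_cvg (F := 0^'+) (u_ := fun t : R => t *: c) _ C_closed).
  by near=> t; apply: C_cone.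
rewrite -[X in _ --> X](scale0r c); apply: cvg_at_right_filter.
exact: scalel_continuous.
Unshelve. all: by end_near. Qed.

Section Merit.
Context {R : realType} {X Y : normedModType R}.
Variables (A : set X) (C : set Y) (F : {linear X -> Y}).
Hypothesis A_nonempty : A !=set0.
Hypothesis C_nonempty : C !=set0.
Hypothesis theta_lty : forall x : X, (merit A C F x < +oo)%E.

(** If [C] were the whole space, its signed distance would be [-oo] and the merit function [+oo]. *)
Lemma merit_lty_proper : ~` C !=set0.
Proof.
apply/set0P/eqP => C_full; have [a Aa] := A_nonempty.
have := theta_lty a; rewrite ltNge => /negP; apply.
apply: ereal_sup_ubound; exists a => //.
by rewrite -[C]setCK C_full setC0 signed_dist_setT.
Qed.

Lemma merit_fin_num (x : X) : merit A C F x \is a fin_num.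
Proof.
rewrite fin_numE (lt_eqF (theta_lty x)) andbT gt_eqF//.
have [a Aa] := A_nonempty.
have fin : signed_dist C (F x - F a) \is a fin_num.
  by apply: signed_dist_fin_num => //; exact: merit_lty_proper.
apply: (@lt_le_trans _ _ (- signed_dist C (F x - F a)%R)%E).
  by rewrite ltNye_eq fin_numN fin.
by apply: ereal_sup_ubound; exists a.
Qed.

(** Take [a = x] in the supremum: 0 lies in [C], so the signed distance at 0 is at most 0. *)
Lemma merit_ge0 (x : X) : closed C -> cone C -> A x -> (0 <= merit A C F x)%E.
Proof.
move=> C_closed C_cone Ax.
have C0 : C 0 by exact: closed_cone0.
apply: (@le_trans _ _ (- signed_dist C (F x - F x)%R)%E); last first.
  by apply: ereal_sup_ubound; exists x.
rewrite subrr leeNr oppe0 /signed_dist leeBlDr; last first.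
  exact/dist_set_fin_num/merit_lty_proper.
rewrite add0e; apply: (@le_trans _ _ 0)%E.
  by apply: ereal_inf_lbound; exists 0; rewrite ?subr0 ?normr0.
by apply: le_ereal_inf_tmp => _ [v _ <-]; rewrite lee_fin.
Qed.

(** With [K] a bound for the operator [F], every term of the supremum is [2 * K]-Lipschitz in [x],
    uniformly in [a]. *)
Lemma merit_lipschitz : continuous F -> exists2 K : R, 0 <= K &
  forall x z, fine (merit A C F x) <= fine (merit A C F z) + K * `|x - z|.
Proof.
move=> /linear_bounded_continuous/linear_boundedP F_bounded.
have [K [K0 FK]] : exists K, 0 <= K /\ forall x, `|F x| <= K * `|x|.
  near (+oo : set_system R) => K; exists K; split; near: K => //.
  exact: nbhs_pinfty_ge.
exists (2 * K) => [|x z]; first by rewrite mulr_ge0.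
rewrite -lee_fin EFinD !fineK ?merit_fin_num//.
apply: ge_ereal_sup => _ [a Aa <-].
have CC := merit_lty_proper.
have za : (- signed_dist C (F z - F a)%R <= merit A C F z)%E.
  by apply: ereal_sup_ubound; exists a.
have := le_signed_distD R Y C (F z - F a) (F x - F a) C_nonempty CC.
have := FK (x - z); rewrite linearB /= opprB addrA subrK distrC.
move: za (merit_fin_num z).
case: (merit A C F z) => // t.
have := signed_dist_fin_num R Y C (F z - F a) C_nonempty CC.
have := signed_dist_fin_num R Y C (F x - F a) C_nonempty CC.
case: (signed_dist C (F x - F a)) => // u _.
case: (signed_dist C (F z - F a)) => // v _.
by rewrite -!EFinN -!EFinD !lee_fin => ? _ ? ?; lra.
Unshelve. all: by end_near. Qed.

End Merit.

Lemma contingent_descent (R : realType) (X : normedModType R) (A : set X)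
    (f : X -> R) (K m : R) (x d : X) :
  0 < m -> 0 <= K -> (forall u v, f u <= f v + K * `|u - v|) ->
  contingent_cone A x d -> `|d| = 1 ->
  (dir_deriv (EFin \o f) x d < (- m)%:E)%E ->
  exists2 z, A z & f z < f x - m / 2 * `|z - x|.
Proof.
move=> m0 K0 fK [t [e [t0 tcvg ecvg Ate]]] d1 slope.
set q := fun s : R =>
  (((f (x + s *: d)%R)%:E - (f x)%:E) * (s^-1)%R%:E)%E.
(* Where the limit fails to exist, [lim] takes the junk value 0. *)
have qcvg : cvg (q s @[s --> (0%R : R)^'+])%E.
  apply: contrapT => /dvgP qdvg.
  by move: slope; rewrite /dir_deriv qdvg lte_fin ltNge oppr_le0 ltW.
have qm : \forall s \near (0 : R)^'+, (q s < (- m)%:E)%E.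
  have lt_nbhs : nbhs (dir_deriv (EFin \o f) x d) [set l | (l < (- m)%:E)%E].
    by apply: open_nbhs_nbhs; split; [exact: open_ereal_lt_ereal|].
  exact: (qcvg _ lt_nbhs).
(* A right neighbourhood of 0 constrains only positive arguments; every [t k] is one. *)
have tm : \forall k \near \oo, (q (t k) < (- m)%:E)%E.
  have : \forall k \near \oo, 0 < t k -> (q (t k) < (- m)%:E)%E.
    exact: (tcvg _ qm).
  by apply: filterS => k; apply.
(* If [|d - e k| < r], then replacing [d] by [e k], which keeps the point in [A], costs less than
   half of the rate [m]: both the Lipschitz error and the excess of [|e k|] over 1 are absorbed. *)
pose r := (m / 2) / (m / 2 + K).
have mK0 : 0 < m / 2 + K by lra.
have r0 : 0 < r by rewrite divr_gt0//; lra.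
have [k [qk ek]] : exists k, (q (t k) < (- m)%:E)%E /\ `|d - e k| < r.
  near \oo => k; exists k; split; near: k => //.
  by move/cvgrPdist_lt : ecvg; apply.
exists (x + t k *: e k); first exact: Ate.
have tk0 := t0 k.
have dec : f (x + t k *: d) < f x - m * t k.
  by move: qk; rewrite /q lte_fin ltr_pdivrMr//; lra.
have lip := fK (x + t k *: e k) (x + t k *: d).
have eq1 : `|x + t k *: e k - (x + t k *: d)| = t k * `|d - e k|.
  rewrite opprD addrACA subrr add0r -scalerBr normrZ gtr0_norm//.
  by rewrite distrC.
have eq2 : `|x + t k *: e k - x| = t k * `|e k|.
  by rewrite addrAC subrr add0r normrZ gtr0_norm.
have ek1 : `|e k| <= 1 + `|d - e k|.
  by rewrite -d1 -lerBlDl (le_trans (lerB_dist _ _))// distrC.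
have bound : m / 2 * `|e k| + K * `|d - e k| < m.
  have h : (m / 2 + K) * `|d - e k| < m / 2.
    by rewrite mulrC -ltr_pdivlMr.
  have : m / 2 * `|e k| <= m / 2 * (1 + `|d - e k|) by rewrite ler_wpM2l//; lra.
  lra.
have : t k * (m / 2 * `|e k| + K * `|d - e k|) < t k * m by rewrite ltr_pM2l.
by rewrite eq1 in lip; rewrite eq2; lra.
Unshelve. all: by end_near. Qed.

(** The penalty weight equals the descent rate [m], so a descent point from the minimiser would
    lower the penalised function strictly. *)
Lemma compact_descent_error_bound (R : realType) (X : normedModType R)
    (A E : set X) (f : X -> R) (m : R) :
  compact A -> continuous f -> 0 < m -> (forall y, A y -> 0 <= f y) ->
  (forall y, A y -> ~ E y -> exists2 z, A z & f z < f y - m * `|z - y|) ->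
  forall x, A x -> exists2 y, E y & m * `|x - y| <= f x.
Proof.
move=> A_compact f_cont m0 f0 descent x Ax.
have : {within A, continuous (fun y => f y + m * `|y - x|)}.
  apply: continuous_subspaceT => y; apply: cvgD; first exact: f_cont.
  apply: cvgMl_tmp; apply: cvg_norm; apply: cvgB; [exact: cvg_id|exact: cvg_cst].
case/(compact_EVT_min (ex_intro _ x Ax) A_compact) => y /set_mem Ay ymin.
have yx : m * `|x - y| <= f x.
  have := ymin x (mem_set Ax); rewrite subrr normr0 mulr0 addr0 distrC.
  by have := f0 y Ay; lra.
exists y => //; apply: contrapT => /(descent y Ay)[z Az zy].
have := ymin z (mem_set Az).
have : m * `|z - x| <= m * (`|z - y| + `|y - x|).
  by rewrite ler_pM2l// ler_distD.
lra.
Qed.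

Theorem theorem6p3 (R : realType) (X Y : completeNormedModType R)
    (A : set X) (C : set Y) (F : {linear X -> Y})
    (A_nonempty : A !=set0) (A_compact : compact A) (A_convex : convex_set A)
    (C_closed : closed C) (C_convex : convex_set C) (C_cone : cone C)
    (C_solid : C° !=set0)
    (F_continuous : continuous F)
    (F_meets : (range F `&` C°) !=set0)
    (theta_lty : forall x : X, (merit A C F x < +oo)%E)
    (slope : (ereal_sup [set min_slope A C F x |
                x in A `\` weakly_efficient A C F] < 0)%E) :
  exists tau : R, 0 < tau /\
    forall x : X, A x ->
      (dist_set (weakly_efficient A C F) x <= tau%:E * merit A C F x)%E.
Proof.
have C_nonempty : C !=set0.
  by have [c /interior_subset Cc] := C_solid; exists c.
pose f x := fine (merit A C F x).
have meritE : merit A C F = EFin \o f.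
  by apply/funext => x /=; rewrite fineK// merit_fin_num.
have f0 x : A x -> 0 <= f x.
  by move=> Ax; apply: fine_ge0; exact: merit_ge0.
have [K K0 fK] := merit_lipschitz A C F A_nonempty C_nonempty theta_lty
  F_continuous.
have f_cont : continuous f.
  move=> x; apply/cvgrPdist_le => e e0; near=> z.
  have Kz : K * `|x - z| <= e.
    (* [K] may be 0, so [K + 1] serves as the divisor. *)
    apply: (@le_trans _ _ ((K + 1) * `|x - z|)); first by rewrite ler_wpM2r//; lra.
    rewrite mulrC -ler_pdivlMr ?ltr_wpDl//; near: z.
    by apply: cvgr_dist_le; [exact: cvg_id|rewrite divr_gt0// ltr_wpDl].
  have := fK x z; have := fK z x; rewrite (distrC z) -/(f x) -/(f z) => ? ?.
  by rewrite ler_norml; lra.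
have [m m0 slopem] : exists2 m : R, 0 < m &
    (ereal_sup [set min_slope A C F x |
       x in A `\` weakly_efficient A C F] < (- m)%:E)%E.
  (* The supremum is [-oo] when every point of [A] is weakly efficient; any positive [m] then
     works. *)
  case: (ereal_sup _) slope => [s|//|_]; last by exists 1; rewrite ?ltNyr.
  by rewrite lte_fin => s0; exists (- s / 2); rewrite ?lte_fin; lra.
exists (m / 2)^-1; split; first by rewrite invr_gt0; lra.
move=> x Ax; rewrite meritE/= -EFinM.
have [|y Ey yx] := compact_descent_error_bound R X A (weakly_efficient A C F) f
    (m / 2) A_compact f_cont ltac:(lra) f0 _ x Ax.
  move=> y Ay nEy.
  have : (min_slope A C F y < (- m)%:E)%E.
    apply: le_lt_trans slopem; apply: ereal_sup_ubound.
    by exists y.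
  (* Strict inequality yields an actual direction, whether or not the infimum is attained. *)
  case/ereal_inf_lt => _ [d [Td d1] <-]; rewrite meritE.
  exact: contingent_descent fK Td d1.
apply: (@le_trans _ _ `|x - y|%:E); first by apply: ereal_inf_lbound; exists y.
by rewrite lee_fin mulrC ler_pdivlMr 1?mulrC//; lra.
Unshelve. all: by end_near. Qed.
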